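(* Let $\mu$ be a finite positive non-discrete Borel measure on the unit circle $\mathbb{T}$ with total mass $1$, with orthonormal Szegő polynomials $\varphi_n$ and Schur parameters $\alpha_k$, and let $\mathcal{S}$ be any snake-shaped matrix factorization associated with $\mu$, i.e. the one determined by an arbitrary sequence $\{s_k\}_{k\ge1}$ in $\{0,1\}$. Let $n$ be a positive integer. Then: (1) The eigenvalues of the principal $n\times n$ submatrix (rows and columns $0,\dots,n-1$) of $\mathcal{S}$ are the zeros of the $n$th Szegő polynomial $\varphi_n(z)$. (2) Let $\theta\in\mathbb{R}$ be fixed. The eigenvalues of the $n\times n$ unitary matrix $\mathcal{S}_{n-1}$ (constructed with the parameter $\theta$) are distinct, belong to $\mathbb{T}$ and appear as nodes in an $n$-point Szegő quadrature formula for the measure $\mu$. The corresponding quadrature weights are the first components of the normalized eigenvectors of $\mathcal{S}_{n-1}$.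
   Context: Rows and columns are indexed from $0$; the first component of a vector is the one of index $0$. Inner product: $\langle f,g\rangle=\int_{-\pi}^{\pi}\overline{f(e^{i\theta})}\,g(e^{i\theta})\,d\mu(\theta)$. $\varphi_k$ is the orthonormal polynomial of degree $k$ with positive leading coefficient (Gram-Schmidt applied to $1,z,z^2,\dots$) and $\varphi_k^*(z)=z^k\overline{\varphi_k(1/\bar z)}$. The Schur parameters $\alpha_k$, $|\alpha_k|<1$, and $\rho_k=\sqrt{1-|\alpha_k|^2}$ are determined by $z\varphi_k=\overline{\alpha_k}\varphi_k^*+\rho_k\varphi_{k+1}$, $\varphi_{k+1}^*=\rho_k\varphi_k^*-\alpha_k\varphi_{k+1}$, $k\ge0$. $G_{k,k+1}$ is the infinite matrix equal to the identity except that its block in rows and columns $\{k,k+1\}$ is $\begin{bmatrix}\overline{\alpha_k}&\rho_k\\ \rho_k&-\alpha_k\end{bmatrix}$. Define $\mathcal{S}^{(0)}=G_{0,1}$ and, for $k\ge1$, $\mathcal{S}^{(k)}=\mathcal{S}^{(k-1)}G_{k,k+1}$ if $s_k=0$, $\mathcal{S}^{(k)}=G_{k,k+1}\mathcal{S}^{(k-1)}$ if $s_k=1$. The snake-shaped matrix factorization $\mathcal{S}$ is the infinite matrix whose principal $n\times n$ submatrix coincides with that of $\mathcal{S}^{(n-1)}$ for every $n\ge1$. $\mathcal{S}_{n-1}$ is the principal $n\times n$ submatrix of the matrix obtained from the same product when the block of the factor $G_{n-1,n}$ is replaced by $\mathrm{diag}(e^{i\theta},e^{i\tilde\theta})$ ($\tilde\theta\in\mathbb{R}$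 arbitrary and irrelevant). Explicitly, with $D_\theta=\mathrm{diag}(1,\dots,1,e^{i\theta})$ of size $n$ and $T$ the principal $n\times n$ submatrix of $\mathcal{S}^{(n-2)}$: $\mathcal{S}_{n-1}=TD_\theta$ if $s_{n-1}=0$ and $\mathcal{S}_{n-1}=D_\theta T$ if $s_{n-1}=1$ (for $n=1$, $\mathcal{S}_0=[e^{i\theta}]$). Normalized eigenvectors: the eigenvectors are scaled in such a way that they form an orthonormal system and their first components are real positive numbers. An $n$-point Szegő quadrature formula for $\mu$ is a rule $I_n(f)=\sum_{j=1}^n\lambda_jf(z_j)$ with distinct nodes $z_j\in\mathbb{T}$ and weights $\lambda_j$ such that $I_n(L)=\int_{-\pi}^{\pi}L(e^{i\theta})\,d\mu(\theta)$ for all $L\in\mathrm{span}\{z^m:-n+1\le m\le n-1\}$.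
   Formalization: The quadrature weights are the squares of the first components of the normalized eigenvectors, not the first components themselves; as written the claim fails for every n ≥ 2, since the squares of these positive components sum to 1 and so do the weights. *)

(* Defs.v *)
From HB Require Import structures.
From mathcomp Require Export all_boot all_order all_algebra.
From mathcomp.real_closed Require Export complex.
From mathcomp Require Export all_classical all_reals all_analysis.
Set Implicit Arguments.
Unset Strict Implicit.
Unset Printing Implicit Defensive.
Import Order.TTheory GRing.Theory Num.Theory.
Import numFieldNormedType.Exports.
Local Open Scope classical_set_scope.
Local Open Scope ring_scope.

Section Circle.
(* The complex numbers are R[i]. *)
Variable R : realType.
Local Notation C := R[i].

Definition expi (t : R) : C := (cos t +i* sin t)%C.

(* A Borel measure on the unit circle is given in the angular variable, as a  *)
(* measure on R carried by ]-pi, pi], which expi maps bijectively onto the    *)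
(* circle.                                                                    *)
Definition angles : set R := `]- pi, pi].

Definition on_circle (mu : {measure set (measurableTypeR R) -> \bar R}) : Prop :=
  mu (~` angles) = 0%E.

(* The (compact) support is not a discrete set, i.e. is infinite: mu is not   *)
(* carried by finitely many points.                                           *)
Definition nondiscrete (mu : {measure set (measurableTypeR R) -> \bar R}) : Prop :=
  forall A : set R, finite_set A -> (0 < mu (angles `\` A))%E.

Definition circle_integral (mu : {measure set (measurableTypeR R) -> \bar R})
    (f : C -> C) : C :=
  ((\int[mu]_(t in angles) complex.Re (f (expi t)))%R +i*
   (\int[mu]_(t in angles) complex.Im (f (expi t)))%R)%C.

Definition inner (mu : {measure set (measurableTypeR R) -> \bar R})
    (f g : C -> C) : C :=
  circle_integral mu (fun z => (f z)^* * g z).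

(* These conditions determine phi, as the outcome of Gram-Schmidt on the      *)
(* monomials; for complex numbers 0 < x means that x is real and positive.    *)
Definition szego_polynomials (mu : {measure set (measurableTypeR R) -> \bar R})
    (phi : nat -> {poly C}) : Prop :=
  [/\ forall k, size (phi k) = k.+1,
      forall k, 0 < lead_coef (phi k) &
      forall j k, inner mu (horner (phi j)) (horner (phi k)) = (j == k)%:R].

Definition reversed (k : nat) (p : {poly C}) : {poly C} :=
  \poly_(i < k.+1) (p`_(k - i))^*.

(* p^*(z) = z^k conj(p(1 / conj z)) *)
Lemma reversedE k (p : {poly C}) (z : C) : (size p <= k.+1)%N -> z != 0 ->
  (reversed k p).[z] = z ^+ k * (p.[(z^*)^-1])^*.
Proof.
move=> sp z0; rewrite horner_poly (horner_coef_wide _ sp) rmorph_sum mulr_sumr.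
rewrite (reindex_inj rev_ord_inj) /=; apply: eq_bigr => i _.
rewrite subSS subKn -1?ltnS// rmorphM rmorphXn /= fmorphV /= conjCK mulrCA.
by rewrite expfB_cond ?exprVn// (negbTE z0) add0n -ltnS ltn_ord.
Qed.

Definition rho (alpha : nat -> C) (k : nat) : C :=
  sqrtC (1 - `|alpha k| ^+ 2).

Definition schur_parameters (phi : nat -> {poly C}) (alpha : nat -> C) : Prop :=
  forall k, [/\ `|alpha k| < 1,
    'X * phi k =
      (alpha k)^* *: reversed k (phi k) + rho alpha k *: phi k.+1 &
    reversed k.+1 (phi k.+1) =
      rho alpha k *: reversed k (phi k) - alpha k *: phi k.+1].

Definition infmx := nat -> nat -> C.

(* The sum ranges over the indices l whose term is nonzero, and is 0 if there *)
(* are infinitely many; all the products below have finitely many.            *)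
Definition infmul (A B : infmx) : infmx :=
  fun i j => \sum_(l \in [set: nat]) A i l * B l j.

Definition principal (n : nat) (A : infmx) : 'M[C]_n :=
  \matrix_(i < n, j < n) A i j.

(* The identity, except for the block [a b; c d] in rows and columns k, k+1.  *)
Definition block_at (k : nat) (a b c d : C) : infmx := fun i j =>
  if (i == k) && (j == k) then a
  else if (i == k) && (j == k.+1) then b
  else if (i == k.+1) && (j == k) then c
  else if (i == k.+1) && (j == k.+1) then d
  else (i == j)%:R.

Definition givens (alpha : nat -> C) (k : nat) : infmx :=
  block_at k (alpha k)^* (rho alpha k) (rho alpha k) (- alpha k).

(* s k = true stands for s_k = 1; the value s 0 is not used.                  *)
Fixpoint snake_product (G : nat -> infmx) (s : nat -> bool) (k : nat) : infmx :=
  if k is k'.+1 then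
    if s k then infmul (G k) (snake_product G s k')
    else infmul (snake_product G s k') (G k)
  else G 0%N.

(* Its principal submatrices are identified in principal_snake.               *)
Definition snake (alpha : nat -> C) (s : nat -> bool) : infmx :=
  fun i j => snake_product (givens alpha) s (maxn i j) i j.

Lemma infmul_unitr (A B : infmx) i j :
  (forall l, B l j = (l == j)%:R) -> infmul A B i j = A i j.
Proof.
move=> Bj; rewrite /infmul -(@fsbig_widen _ _ _ _ [set j])//; last first.
  by move=> l [_ /eqP lj] /=; rewrite Bj (negbTE lj) mulr0.
by rewrite fsbig_set1 Bj eqxx mulr1.
Qed.

Lemma infmul_unitl (A B : infmx) i j :
  (forall l, A i l = (i == l)%:R) -> infmul A B i j = B i j.
Proof.
move=> Ai; rewrite /infmul -(@fsbig_widen _ _ _ _ [set i])//; last first.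
  by move=> l [_ /eqP li] /=; rewrite Ai eq_sym (negbTE li) mul0r.
by rewrite fsbig_set1 Ai eqxx mul1r.
Qed.

Lemma givens_unitr alpha k l j : (j < k)%N ->
  givens alpha k l j = (l == j)%:R.
Proof.
move=> jk; rewrite /givens /block_at (ltn_eqF jk) (ltn_eqF (leqW jk)).
by rewrite !andbF.
Qed.

Lemma givens_unitl alpha k i l : (i < k)%N ->
  givens alpha k i l = (i == l)%:R.
Proof.
by move=> ik; rewrite /givens /block_at (ltn_eqF ik) (ltn_eqF (leqW ik)).
Qed.

Lemma principal_snake alpha s n :
  principal n.+1 (snake alpha s) =
  principal n.+1 (snake_product (givens alpha) s n).
Proof.
apply/matrixP => i j; rewrite !mxE /snake.
have : (maxn i j <= n)%N by rewrite geq_max (leq_ord i) (leq_ord j).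
move: (leq_maxl i j) (leq_maxr i j); move: (maxn i j) => m im jm.
elim: n {i j} (nat_of_ord i) (nat_of_ord j) im jm => [|n IH] i j im jm.
  by rewrite leqn0 => /eqP ->.
rewrite leq_eqVlt => /predU1P[->//|]; rewrite ltnS => mn; rewrite IH//=.
case: ifP => _; [rewrite infmul_unitl//|rewrite infmul_unitr//] => l.
- by apply: givens_unitl; rewrite ltnS (leq_trans im).
- by apply: givens_unitr; rewrite ltnS (leq_trans jm).
Qed.

(* S_{n-1}: the factor G_{n-1,n} is replaced by                               *)
(* diag(e^{i theta}, e^{i theta'}).                                           *)
Definition truncated_snake (alpha : nat -> C) (s : nat -> bool)
    (theta theta' : R) (n : nat) : 'M[C]_n :=
  principal n (snake_product
    (fun k => if k == n.-1 then block_at k (expi theta) 0 0 (expi theta')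
              else givens alpha k) s n.-1).

(* Laurent polynomials \sum_(-n+1 <= m <= n-1) c_m z^m, with the index        *)
(* shifted by n-1.                                                            *)
Definition laurent (n : nat) (c : 'I_(n.*2.-1) -> C) (z : C) : C :=
  \sum_(k < n.*2.-1) c k * z ^ (k%:Z - n.-1%:Z).

Definition szego_quadrature (mu : {measure set (measurableTypeR R) -> \bar R})
    (n : nat) (z w : 'I_n -> C) : Prop :=
  [/\ injective z, forall j, `|z j| = 1 &
      forall c : 'I_(n.*2.-1) -> C,
        \sum_(j < n) w j * laurent c (z j) = circle_integral mu (laurent c)].

(* v j is the eigenvector for z j; i0 is the index of the first component.    *)
Definition normalized_eigenvectors (n : nat) (i0 : 'I_n) (M : 'M[C]_n)
    (z : 'I_n -> C) (v : 'I_n -> 'cV[C]_n) : Prop :=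
  [/\ forall j, M *m v j = z j *: v j,
      forall j k, \sum_(i < n) (v j i 0)^* * v k i 0 = (j == k)%:R &
      forall j, 0 < v j i0 0].

End Circle.

(* Main.v *)
(* Write M_c for the n x n matrix obtained from the snake product by replacing *)
(* its last factor by diag(1, ..., 1, c); the principal submatrix of the snake *)
(* is M_c with c = conj alpha_(n-1), and S_(n-1) is M_c with c = e^(i theta).  *)
(* The Schur recurrences say that G_k sends the row (phi_k^*, phi_(k+1)) to    *)
(* (z phi_k, phi_(k+1)^* ).  Hence, for |z| = 1, M_c has a left eigenvector    *)
(* with entries z^-p phi_k(z) or z^-(p+1) phi_k^*(z) as soon as                *)
(* psi_c(z) = z phi_(n-1)(z) - c phi_(n-1)^*(z) vanishes; since rho_k <> 0,    *)
(* a left eigenvector is determined by its first component, so there are no    *)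
(* others.  For |c| = 1 the matrix is unitary, hence diagonalizable, and so    *)
(* has n distinct eigenvalues, the zeros of psi_c; therefore its               *)
(* characteristic polynomial is proportional to psi_c.  Both polynomials being *)
(* affine in c, this remains true for all c, and for c = conj alpha_(n-1) the  *)
(* polynomial psi_c is rho_(n-1) phi_n.  The zeros of psi_c do not depend on   *)
(* s, and for s = 0 the eigenvectors have the entries phi_k(z_j): their        *)
(* orthogonality is that of phi_0, ..., phi_(n-1) for the discrete measure     *)
(* with weights 1 / sum_k |phi_k(z_j)|^2 at z_j, which is the quadrature       *)
(* formula.  For any s the entries have the moduli |phi_k(z_j)|, so these      *)
(* weights are the squares of the first normalized components.                 *)
Require Import Defs.
From mathcomp Require Import measurable_realfun ring.
Set Implicit Arguments.
Unset Strict Implicit.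
Unset Printing Implicit Defensive.
Import Order.TTheory GRing.Theory Num.Theory.
Import numFieldNormedType.Exports.
Local Open Scope classical_set_scope.
Local Open Scope ring_scope.

(** Two facts about left eigenvectors of the capped snake carry the proof. The Laurent basis
    evaluated at [z] satisfies every eigenvalue equation but the last, whose defect is a nonzero
    multiple of the paraorthogonal polynomial at [z] ([capped_act_basis]); and a row satisfying
    these equations is determined by its first entry ([capped_act_eigen_eq0]). For a unimodular
    corner entry [c], unitarity then gives a simple spectrum on the circle
    ([unitary_simple_spectrum]), and [char_poly_capped_snake] extends the resulting formula to all
    [c]. Part (1), multiplicities included, is the case where [c] is the conjugate of the last Schur
    parameter. For part (2), [discrete_orthonormal] moves the orthonormality of the [phi k] to the
    nodes, [szego_quadrature_orthonormal] turns it into exactness, and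
    [normalized_eigenvectors_first] identifies the weights. *)

Section RowAction.
Variable C : numClosedFieldType.
Implicit Types (v : nat -> C) (alpha rh : nat -> C) (s : nat -> bool).

(* Infinite matrices act on rows from the right; [act] is the action of       *)
(* [block_at k a b c d], and [scale m c] that of the corner factor            *)
(* diag(1, ..., 1, c) of size m + 1.                                          *)
Definition act k (a b c d : C) v : nat -> C := fun j =>
  if j == k then a * v k + c * v k.+1
  else if j == k.+1 then b * v k + d * v k.+1 else v j.

Definition scale m (c : C) v : nat -> C := fun j =>
  if j == m then c * v j else v j.

(* The factors are G_0, ..., G_(k-1).  The side of G_0 is immaterial, whence  *)
(* the harmless test of [s 0].                                                *)
Fixpoint snake_act alpha rh s k v : nat -> C :=
  if k is k'.+1 then
    let G := act k' (alpha k')^* (rh k') (rh k') (- alpha k') in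
    if s k' then snake_act alpha rh s k' (G v)
    else G (snake_act alpha rh s k' v)
  else v.

Definition capped_act alpha rh s m c v : nat -> C :=
  if s m then snake_act alpha rh s m (scale m c v)
  else scale m c (snake_act alpha rh s m v).

Lemma snake_act_gt alpha rh s k v j : (k < j)%N ->
  snake_act alpha rh s k v j = v j.
Proof.
elim: k v => //= k IH v kj; have kj' := ltnW kj.
case: ifP => _; first rewrite IH//.
  by rewrite /act (gtn_eqF kj') (gtn_eqF kj).
by rewrite /act (gtn_eqF kj') (gtn_eqF kj) IH.
Qed.

Lemma snake_act_eq0 alpha rh s k v : (forall i, (i <= k)%N -> v i = 0) ->
  forall i, (i <= k)%N -> snake_act alpha rh s k v i = 0.
Proof.
elim: k v => //= k IH v v0 i ik.
case: ifP => _.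
  have Gv0 j : (j <= k.+1)%N ->
      act k (alpha k)^* (rh k) (rh k) (- alpha k) v j = 0.
    by move=> jk; rewrite /act !v0// !mulr0 addr0 !if_same.
  move: ik; rewrite leq_eqVlt => /predU1P[->|ik].
    by rewrite snake_act_gt// Gv0.
  by apply: IH => // j jk; apply: Gv0; apply: leqW.
have IHv j : (j <= k)%N -> snake_act alpha rh s k v j = 0.
  by apply: IH => l lk; apply: v0; apply: leqW.
rewrite /act IHv// snake_act_gt// v0// !mulr0 addr0.
case: eqP => // /eqP ik'; case: eqP => // /eqP ik''.
by rewrite IHv// -ltnS ltn_neqAle ik''.
Qed.

(** * Eigenvalue equations for rows under a snake product *)

Section Eigen.
Variables (alpha rh : nat -> C) (s : nat -> bool) (z : C).
Hypotheses (rh0 : forall k, rh k != 0) (z0 : z != 0).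

(** Each factor couples two neighbouring entries through the nonzero [rh k], so the first [k]
    equations propagate the zero from entry 0 to entry [k]. When [s k] holds, the induction runs on
    the row [u] already multiplied by the last factor. *)
Lemma snake_act_eigen_eq0 k v : v 0%N = 0 ->
  (forall i, (i < k)%N -> snake_act alpha rh s k v i = z * v i) ->
  forall i, (i <= k)%N -> v i = 0.
Proof.
elim: k v => [|k IH] v v0 /= vz i ik; first by move: ik; rewrite leqn0 => /eqP->.
case: ifP vz => _ vz.
  set u := act _ _ _ _ _ v in vz.
  have u_lt j : (j < k)%N -> u j = v j.
    by move=> jk; rewrite /u /act (ltn_eqF jk) (ltn_eqF (leqW jk)).
  have u0 : u 0%N = 0.
    (* For [k] = 0 the factor alters entry 0 itself; the eigenvalue equation at 0 then gives the
       zero. *)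
    by case: (posnP k) vz => [-> /(_ 0%N isT)/=->|/u_lt->//]; rewrite v0 mulr0.
  have {}IH : forall j, (j <= k)%N -> u j = 0.
    by apply: IH => // j jk; rewrite vz ?u_lt// ltnW.
  have vk : v k = 0.
    apply/eqP; rewrite -(mulrI_eq0 _ (mulfI z0)) -vz//.
    by rewrite (snake_act_eq0 _ _ _ IH).
  have vk1 : v k.+1 = 0.
    apply/eqP; rewrite -(mulrI_eq0 _ (mulfI (rh0 k))).
    by move: (IH k (leqnn k)); rewrite /u /act eqxx vk mulr0 add0r => ->.
  move: ik; rewrite leq_eqVlt => /predU1P[->//|].
  by rewrite ltnS leq_eqVlt => /predU1P[->//|jk]; rewrite -u_lt// IH// ltnW.
have {}IH : forall j, (j <= k)%N -> v j = 0.
  apply: IH => // j jk; rewrite -vz ?(leqW jk)//.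
  by rewrite [RHS]/act (ltn_eqF jk) (ltn_eqF (leqW jk)).
move: ik; rewrite leq_eqVlt => /predU1P[->|]; last exact: IH.
apply/eqP; rewrite -(mulrI_eq0 _ (mulfI (rh0 k))).
have /esym := vz k (leqnn _); rewrite IH// mulr0 /act eqxx.
by rewrite (snake_act_eq0 _ _ _ IH)// mulr0 add0r snake_act_gt// => <-.
Qed.

Lemma capped_act_eigen_eq0 (m : nat) (c : C) v : c != 0 -> v 0%N = 0 ->
  (forall i, (i < m)%N -> capped_act alpha rh s m c v i = z * v i) ->
  forall i, (i <= m)%N -> v i = 0.
Proof.
rewrite /capped_act => c0 v0; case: ifP => _ vz; last first.
  apply: snake_act_eigen_eq0 => // i im; rewrite -vz//.
  by rewrite /scale (ltn_eqF im).
have u_lt j : (j < m)%N -> scale m c v j = v j.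
  by move=> jm; rewrite /scale (ltn_eqF jm).
have u0 i : (i <= m)%N -> scale m c v i = 0.
  apply: snake_act_eigen_eq0 => [|j jm]; last by rewrite u_lt// vz.
  by rewrite /scale v0 mulr0 if_same.
move=> i im; have := u0 _ im; rewrite /scale; case: ifP => // _ /eqP.
by rewrite mulf_eq0 (negbTE c0) => /eqP.
Qed.

Variables (f g : nat -> C).
Hypothesis fP : forall k, z * f k = (alpha k)^* * g k + rh k * f k.+1.
Hypothesis gP : forall k, g k.+1 = rh k * g k - alpha k * f k.+1.

Definition shift k : C := z^-1 ^+ (\sum_(i < k) s i)%N.

(* At a point z of the circle, with f k = phi_k(z) and g k = phi_k^*(z), this *)
(* is the value of the k-th element of the orthonormal Laurent basis in which *)
(* the snake represents multiplication by z.                                  *)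
Definition snake_basis k : C :=
  shift k * (if s k then z^-1 * g k else f k).

Lemma shiftS k : shift k.+1 = shift k * (if s k then z^-1 else 1).
Proof. by rewrite /shift big_ord_recr/= exprD; case: (s k). Qed.

(** Each factor performs one Schur step, from the pair [g k], [f k.+1] to the pair [z * f k],
    [g k.+1], up to a common power of [z^-1]. If [s k] holds, this step precedes the induction
    hypothesis, and the extra [z^-1] in the basis turns [z * f k] into the entry [shift k * f k]
    that the hypothesis expects. *)
Lemma snake_act_basis k v :
  (forall i, (i < k)%N -> v i = snake_basis i) -> v k = shift k * f k ->
  f 0%N = g 0%N ->
  (forall i, (i < k)%N -> snake_act alpha rh s k v i = z * snake_basis i) /\
  snake_act alpha rh s k v k = shift k * g k.
Proof.
move=> vb vk fg; elim: k v vb vk => [|k IH] v vb vk /=.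
  by split => //; rewrite vk fg.
have step e a b : a = e * g k -> b = e * f k.+1 ->
    (alpha k)^* * a + rh k * b = z * (e * f k) /\
    rh k * a + - alpha k * b = e * g k.+1.
  move=> -> ->; rewrite gP [z * _]mulrCA fP mulrDr mulrBr; split.
    by congr (_ + _); rewrite mulrCA.
  by rewrite mulNr; congr (_ - _); rewrite mulrCA.
case: ifP => sk; last first.
  have vk0 : v k = shift k * f k by rewrite vb// /snake_basis sk.
  have [wb wk] := IH v (fun i ik => vb i (leqW ik)) vk0.
  rewrite shiftS sk mulr1 in vk *.
  have [s1 s2] := step _ _ _ wk (etrans (snake_act_gt alpha rh s v (ltnSn k)) vk).
  split=> [i|]; last by rewrite /act gtn_eqF// eqxx.
  rewrite ltnS leq_eqVlt /act => /predU1P[->|ik].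
    by rewrite eqxx s1 /snake_basis sk.
  by rewrite (ltn_eqF ik) (ltn_eqF (leqW ik)) wb.
set u := act _ _ _ _ _ v.
rewrite shiftS sk in vk *.
have vk' : v k = shift k * z^-1 * g k by rewrite vb// /snake_basis sk mulrA.
have [s1 s2] := step _ _ _ vk' vk.
have [||wb wk] := IH u.
- by move=> i ik; rewrite /u /act (ltn_eqF ik) (ltn_eqF (leqW ik)) vb// leqW.
- by rewrite /u /act eqxx s1 mulrCA mulrA divfK.
split=> [i|]; last by rewrite snake_act_gt// /u /act gtn_eqF// eqxx.
rewrite ltnS leq_eqVlt => /predU1P[->|ik]; last by rewrite wb.
by rewrite wk /snake_basis sk mulrCA mulVKf.
Qed.

(* The last entry differs because the sequence [s] is only used up to m, and  *)
(* because the corner factor stands to the left of the others when s m = 1.   *)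
Definition capped_basis (m : nat) (c : C) k : C :=
  if k == m then shift m * f m * (if s m then c^-1 else 1) else snake_basis k.

(** Since [e] is nonzero, the row [y] is an eigenrow exactly when [c * g m = z * f m]. *)
Lemma capped_act_basis (m : nat) (c : C) : f 0%N = g 0%N -> c != 0 ->
  let y := capped_basis m c in
  (forall i, (i < m)%N -> capped_act alpha rh s m c y i = z * y i) /\
  exists2 e, e != 0 &
    capped_act alpha rh s m c y m = z * y m + e * (c * g m - z * f m).
Proof.
move=> fg c0 y; rewrite /capped_act.
have y_lt i : (i < m)%N -> y i = snake_basis i.
  by move=> im; rewrite /y /capped_basis (ltn_eqF im).
have sh0 : shift m != 0 by rewrite expf_neq0// invr_eq0.
have ym : y m = shift m * f m * (if s m then c^-1 else 1).
  by rewrite /y /capped_basis eqxx.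
case: ifP ym => sm ym.
  have [||//|wb wk] := @snake_act_basis m (scale m c y).
  - by move=> i im; rewrite /scale (ltn_eqF im) y_lt.
  - by rewrite /scale eqxx ym mulrC divfK.
  split=> [i im|]; first by rewrite wb// y_lt.
  exists (shift m * c^-1); first by rewrite mulf_neq0// invr_eq0.
  rewrite wk ym mulrBr [_ * (c * _)]mulrA divfK//.
  rewrite addrC -addrA; have -> : z * (shift m * f m / c) = shift m / c * (z * f m).
    by ring.
  by rewrite addNr addr0.
rewrite mulr1 in ym.
have [//|//|//|wb wk] := @snake_act_basis m y.
split=> [i im|]; first by rewrite /scale (ltn_eqF im) wb// y_lt.
exists (shift m) => //; rewrite /scale eqxx wk ym.
by rewrite mulrBr [z * (_ * _)]mulrCA addrC subrK mulrCA.
Qed.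

End Eigen.
End RowAction.

(** * Truncation of infinite matrices and their action on rows *)

Section Principal.
Local Open Scope sesquilinear_scope.
Variable R : realType.
Local Notation C := R[i].
Implicit Types (A B : infmx R) (v : nat -> C).

(** If one off-diagonal corner vanishes, inner indices from [N] on contribute nothing to the
    truncated product. *)
Lemma principal_mul N A B :
  (forall i l, (i < N <= l)%N -> A i l = 0) \/
  (forall l j, (j < N <= l)%N -> B l j = 0) ->
  principal N (infmul A B) = principal N A *m principal N B.
Proof.
move=> AB; apply/matrixP => i j; rewrite !mxE /infmul.
transitivity (\sum_(l < N) A i l * B l j); last first.
  by apply: eq_bigr => l _; rewrite !mxE.
rewrite (fsbig_ord _ _ (fun l => A i l * B l j)).
apply/esym/fsbig_widen => // l [_ /= /negP]; rewrite -leqNgt => Nl.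
case: AB => [->|->]; rewrite ?mul0r ?mulr0 ?ltn_ord//.
Qed.

Definition rowvec N v : 'rV[C]_N := \row_i v i.

Lemma rowvec_block N k (a b c d : C) v : (k.+1 < N)%N ->
  rowvec N v *m principal N (block_at k a b c d) = rowvec N (act k a b c d v).
Proof.
move=> kN; apply/rowP => j; rewrite !mxE.
pose k0 := Ordinal (ltnW kN); pose k1 := Ordinal kN.
under eq_bigr => i _ do rewrite !mxE.
rewrite /act (bigD1 k0)//= (bigD1 k1)/=; last by rewrite -val_eqE/= gtn_eqF.
rewrite /block_at eqxx (gtn_eqF (ltnSn k)) eqxx/=.
case: (eqVneq (j : nat) k) => jk.
  rewrite jk (ltn_eqF (ltnSn k)) big1 ?addr0 1?(mulrC a) 1?(mulrC c)// => i /andP[].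
  by rewrite -!val_eqE/= => /negPf-> /negPf->; rewrite mulr0.
case: (eqVneq (j : nat) k.+1) => jk1.
  rewrite big1 ?addr0 1?(mulrC b) 1?(mulrC d)// => i /andP[].
  by rewrite -!val_eqE/= jk1 => /negPf-> /negPf->; rewrite mulr0.
rewrite !andbF/= !mulr0 !add0r (bigD1 j)/=; last first.
  by rewrite -!val_eqE/= jk jk1.
rewrite (negPf jk) (negPf jk1) eqxx mulr1 big1 ?addr0// => i.
rewrite -!andbA -!val_eqE/= => /and3P[/negPf-> /negPf-> /negPf->].
by rewrite mulr0.
Qed.

(** Only the top-left entry of a block at [m] falls inside the truncation to size [m.+1]. *)
Lemma rowvec_corner m (a b c d : C) v :
  rowvec m.+1 v *m principal m.+1 (block_at m a b c d) =
  rowvec m.+1 (scale m a v).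
Proof.
apply/rowP => j; rewrite !mxE.
under eq_bigr => i _ do
  rewrite !mxE /block_at (ltn_eqF (ltn_ord i)) (ltn_eqF (ltn_ord j)) !andbF/=.
rewrite (bigD1 j)//= eqxx andbb big1 ?addr0; last first.
  move=> i; rewrite -val_eqE/= => ij; rewrite (negPf ij).
  by case: ifP => [/andP[/eqP im /eqP jm]|_]; [rewrite im jm eqxx in ij|rewrite mulr0].
by rewrite /scale; case: ifP => _; rewrite ?mulr1 1?mulrC.
Qed.

Lemma adjoint_block N k (a b c d : C) :
  (principal N (block_at k a b c d))^t* =
  principal N (block_at k a^* c^* b^* d^*).
Proof.
apply/matrixP => i j; rewrite !mxE /block_at.
have kk := ltn_eqF (ltnSn k).
case: (eqVneq (i : nat) k) => [->|_]; case: (eqVneq (j : nat) k) => [->|_];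
  rewrite ?kk ?andbF ?andbT //=.
- by case: eqP => // _; rewrite rmorph_nat.
- by case: (_ == k.+1); rewrite // rmorph_nat eq_sym.
by rewrite andbC; case: ifP => // _; rewrite eq_sym rmorph_nat.
Qed.

Lemma rowvec_ext N (A B : 'M[C]_N) :
  (forall v, rowvec N v *m A = rowvec N v *m B) -> A = B.
Proof.
move=> AB; apply/row_matrixP => i; rewrite !rowE.
suff -> : delta_mx 0 i = rowvec N (fun j => (i == j :> nat)%:R) by rewrite AB.
by apply/rowP => j; rewrite !mxE eqxx eq_sym.
Qed.

Lemma unitary_block N k (a b c d : C) : (k.+1 < N)%N ->
  a * a^* + b * b^* = 1 -> c * c^* + d * d^* = 1 -> a * c^* + b * d^* = 0 ->
  principal N (block_at k a b c d) \is unitarymx.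
Proof.
move=> kN ab cd ac; apply/unitarymxP/rowvec_ext => v.
have ca : c * a^* + d * b^* = 0.
  apply: (can_inj (@conjCK C)); rewrite rmorph0 -ac rmorphD !rmorphM /= !conjCK.
  by ring.
rewrite mulmx1 mulmxA adjoint_block !rowvec_block//; apply/rowP => j; rewrite !mxE /act.
rewrite eqxx (gtn_eqF (ltnSn k)) eqxx.
case: eqP => [->|_].
  transitivity (v k * (a * a^* + b * b^*) + v k.+1 * (c * a^* + d * b^*)); first by ring.
  by rewrite ab ca mulr0 mulr1 addr0.
case: eqP => [->|//].
transitivity (v k * (a * c^* + b * d^*) + v k.+1 * (c * c^* + d * d^*)); first by ring.
by rewrite cd ac mulr0 mulr1 add0r.
Qed.

Lemma unitary_corner m (a b c d : C) : `|a| = 1 ->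
  principal m.+1 (block_at m a b c d) \is unitarymx.
Proof.
move=> a1; apply/unitarymxP/rowvec_ext => v.
rewrite mulmx1 mulmxA adjoint_block !rowvec_corner; apply/rowP => j; rewrite !mxE /scale.
by case: eqP => // _; rewrite mulrA [a^* * a]mulrC -normCK a1 expr1n mul1r.
Qed.

End Principal.

(** * The capped snake as a finite unitary matrix *)

Section Snake.
Local Open Scope sesquilinear_scope.
Variable R : realType.
Local Notation C := R[i].
Variables (alpha : nat -> C) (s : nat -> bool) (m : nat).
Variables (c c1 c2 c3 : C).

Definition capped_givens k : infmx R :=
  if k == m then block_at k c c1 c2 c3 else givens alpha k.

Definition capped_snake := principal m.+1 (snake_product capped_givens s m).

Lemma snake_product_id (G : nat -> infmx R) k i j :
  (forall k, exists a b c d, G k = block_at k a b c d) ->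
  (k.+1 < i)%N || (k.+1 < j)%N -> snake_product G s k i j = (i == j)%:R.
Proof.
move=> GP; elim: k i j => [|k IH] i j ij.
  rewrite /=; have [? [? [? [? ->]]]] := GP 0%N; rewrite /block_at.
  by case: i j ij => [|[|i]] [|[|j]].
have blockr l : (k.+2 < j)%N -> G k.+1 l j = (l == j)%:R.
  move=> kj; have [? [? [? [? ->]]]] := GP k.+1.
  by rewrite /block_at (gtn_eqF kj) (gtn_eqF (ltnW kj)) !andbF.
have blockl l : (k.+2 < i)%N -> G k.+1 i l = (i == l)%:R.
  move=> kj; have [? [? [? [? ->]]]] := GP k.+1.
  by rewrite /block_at (gtn_eqF kj) (gtn_eqF (ltnW kj)).
rewrite /=; case/orP: ij => kij; case: ifP => _.
- by rewrite infmul_unitl => [|l]; [rewrite IH// (ltnW kij) | exact: blockl].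
- by rewrite infmul_unitl => [|l]; [exact: blockl | rewrite IH// (ltnW kij)].
- by rewrite infmul_unitr => [|l]; [exact: blockr | rewrite IH// (ltnW kij) orbT].
- by rewrite infmul_unitr => [|l]; [rewrite IH// (ltnW kij) orbT | exact: blockr].
Qed.

Lemma capped_givens_block k :
  exists a b c d, capped_givens k = block_at k a b c d.
Proof.
by rewrite /capped_givens; case: ifP => _; do 4!eexists; reflexivity.
Qed.

(** For [k.+1 = m] the new factor straddles the boundary of the truncation, but the previous product
    is the identity beyond index [k.+1], so [principal_mul] still applies. *)
Lemma principal_snake_productS k : (k < m)%N ->
  let P := principal m.+1 (snake_product capped_givens s k) in
  let G := principal m.+1 (capped_givens k.+1) in
  principal m.+1 (snake_product capped_givens s k.+1) =
  if s k.+1 then G *m P else P *m G.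
Proof.
move=> km /=; have out i j : (k.+1 < i)%N || (k.+1 < j)%N ->
    snake_product capped_givens s k i j = (i == j)%:R.
  exact/snake_product_id/capped_givens_block.
case: ifP => _; apply: principal_mul; [right=> l j|left=> i l] => /andP[jm ml].
- by rewrite out ?gtn_eqF ?(leq_trans _ ml)//; apply: leq_trans ml.
- rewrite out ?ltn_eqF ?(leq_trans jm)// orbC (leq_trans _ ml)//.
Qed.

Lemma rowvec_snake k v : (k < m)%N ->
  rowvec m.+1 v *m principal m.+1 (snake_product capped_givens s k) =
  rowvec m.+1 (snake_act alpha (rho alpha) s k.+1 v).
Proof.
elim: k v => [|k IH] v km.
  rewrite /= /capped_givens (ltn_eqF km) /givens rowvec_block//.
  by case: (s 0%N).
rewrite principal_snake_productS; last exact: ltnW.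
have G u : rowvec m.+1 u *m principal m.+1 (capped_givens k.+1) =
    rowvec m.+1 (act k.+1 (alpha k.+1)^* (rho alpha k.+1) (rho alpha k.+1)
                     (- alpha k.+1) u).
  by rewrite /capped_givens (ltn_eqF km) /givens rowvec_block.
rewrite [snake_act _ _ _ _ _]/=; case: ifP => _.
  by rewrite mulmxA G IH// ltnW.
by rewrite mulmxA IH ?G// ltnW.
Qed.

Lemma rowvec_capped_snake v :
  rowvec m.+1 v *m capped_snake =
  rowvec m.+1 (capped_act alpha (rho alpha) s m c v).
Proof.
have G u : rowvec m.+1 u *m principal m.+1 (capped_givens m) =
    rowvec m.+1 (scale m c u).
  by rewrite /capped_givens eqxx rowvec_corner.
rewrite /capped_snake /capped_act.
move: G (rowvec_snake) (principal_snake_productS) => G.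
case: m G => [|m'] G S PS; first by rewrite G; case: (s 0%N).
rewrite PS//; case: ifP => _; rewrite mulmxA.
  by rewrite G S.
by rewrite S ?G.
Qed.

Hypothesis alpha1 : forall k, `|alpha k| < 1.

Lemma rho_gt0 k : 0 < rho alpha k.
Proof. by rewrite /rho sqrtC_gt0 subr_gt0 expr_lt1. Qed.

Lemma rho_conj k : (rho alpha k)^* = rho alpha k.
Proof. exact/conj_Creal/ger0_real/ltW/rho_gt0. Qed.

Lemma unitary_capped_snake : `|c| = 1 -> capped_snake \is unitarymx.
Proof.
move=> c1'.
suff U k : (k <= m)%N ->
    principal m.+1 (snake_product capped_givens s k) \is unitarymx by exact: U.
have G j : (j <= m)%N -> principal m.+1 (capped_givens j) \is unitarymx.
  rewrite /capped_givens; case: eqVneq => [->|jm] j_le.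
    exact: unitary_corner.
  have rr : rho alpha j * rho alpha j = 1 - `|alpha j| ^+ 2.
    by rewrite -expr2 sqrtCK.
  apply: unitary_block; rewrite ?rho_conj ?conjCK ?rr ?rmorphN/= ?mulrNN.
  - by rewrite ltnS ltn_neqAle jm.
  - by rewrite mulrC -normCK addrC subrK.
  - by rewrite -normCK subrK.
  - by rewrite mulrN mulrC subrr.
elim: k => [|k IH] km; first exact: G.
rewrite principal_snake_productS//.
by case: ifP => _; apply: mul_unitarymx; rewrite ?G ?IH// ltnW.
Qed.

End Snake.

(** * Characteristic polynomials and their dependence on the corner *)

Section CharPoly.
Variable F : fieldType.

Lemma char_poly_trmx n (A : 'M[F]_n) : char_poly A^T = char_poly A.
Proof.
rewrite /char_poly -[RHS]det_tr; congr (\det _).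
by apply/matrixP => i j; rewrite !mxE eq_sym.
Qed.

(** With as many distinct roots as its degree, each polynomial is its leading coefficient times the
    same product of linear factors. *)
Lemma proportional_roots n (z : 'I_n -> F) (p q : {poly F}) :
  injective z -> size p = n.+1 -> size q = n.+1 ->
  (forall j, root p (z j)) -> (forall j, root q (z j)) ->
  lead_coef q *: p = lead_coef p *: q.
Proof.
move=> zI sp sq pz qz.
have sz : size (codom z) = n by rewrite size_codom card_ord.
have uz : uniq_roots (codom z) by rewrite uniq_rootsE; apply/injectiveP.
have E (r : {poly F}) : size r = n.+1 -> (forall j, root r (z j)) ->
    r = lead_coef r *: \prod_(x <- codom z) ('X - x%:P).
  move=> sr rz; apply: all_roots_prod_XsubC; rewrite ?sz//.
  by apply/allP => _ /codomP[j ->].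
by rewrite {1}(E p)// [q in RHS]E// !scalerA mulrC.
Qed.

Lemma mupZ (x c : F) (p : {poly F}) : c != 0 -> mup x (c *: p) = mup x p.
Proof. by move=> c0; rewrite -mul_polyC mupMr// rootC. Qed.

Definition corner_mx m (c : F) : 'M[F]_m.+1 :=
  diag_mx (\row_i if i == ord_max then c else 1).

(* The left-hand side is affine in c. *)
Lemma char_poly_corner m (A : 'M[F]_m.+1) (c : F) : 2%:R != 0 :> F ->
  char_poly (corner_mx m c *m A) =
  ((1 + c) / 2%:R) *: char_poly (corner_mx m 1 *m A) +
  ((1 - c) / 2%:R) *: char_poly (corner_mx m (-1) *m A).
Proof.
move=> two; rewrite /char_poly -!mul_polyC.
apply: (determinant_multilinear (i0 := ord_max)).
- apply/rowP => j; rewrite /corner_mx !mul_diag_mx !mxE eqxx.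
  set a := (_ / _)%:P; set b := (_ / _)%:P.
  (* As the weights add up to 1, the ['X] term of the last row, which does not contain [c], splits
     in the same way. *)
  have ab : a + b = 1 by rewrite -rmorphD -mulrDl addrACA subrr addr0 divff.
  rewrite !polyCM; have -> : c%:P = a - b.
    rewrite -rmorphB -mulrBl opprD addrACA subrr add0r opprK -mulr2n.
    by rewrite -[c *+ 2]mulr_natr mulfK.
  rewrite -[X in X - _ * _]mul1r -ab polyC1 polyCN.
  by ring.
- apply/matrixP => i j; rewrite /corner_mx !mul_diag_mx !mxE.
  by rewrite [_ == ord_max]eq_sym (negPf (neq_lift _ _)).
- apply/matrixP => i j; rewrite /corner_mx !mul_diag_mx !mxE.
  by rewrite [_ == ord_max]eq_sym (negPf (neq_lift _ _)).
Qed.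

End CharPoly.

(** * Unitary matrices whose left eigenvectors have nonzero first entry *)

Section UnitarySpectrum.
Local Open Scope sesquilinear_scope.
Variables (C : numClosedFieldType) (m : nat) (M : 'M[C]_m.+1).
Hypothesis MU : M \is unitarymx.
Hypothesis M_first : forall (a : C) (v : 'rV_m.+1),
  a != 0 -> v 0 0 = 0 -> v *m M = a *: v -> v = 0.

Lemma mulmx_unitary_norm (v : 'rV[C]_m.+1) (a : C) : v != 0 ->
  v *m M = a *: v -> `|a| = 1.
Proof.
move=> v0 vM; have : (v *m M) *m (v *m M)^t* = v *m v^t*.
  by rewrite trmx_mul map_mxM mulmxA mulmxtVK.
have vv : (v *m v^t*) 0 0 != 0.
  apply: contraNneq v0; rewrite mxE => /eqP; rewrite psumr_eq0 => [/allP v0|i _].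
    apply/eqP/rowP => i; rewrite mxE; apply/eqP.
    by have := v0 i (mem_index_enum i); rewrite !mxE mul_conjC_eq0.
  by rewrite !mxE mul_conjC_ge0.
rewrite vM linearZ /= map_mxZ -scalemxAl -scalemxAr scalerA -normCK.
move=> /matrixP/(_ 0 0); rewrite mxE => /eqP.
rewrite -subr_eq0 -[X in _ - X]mul1r -mulrBl mulf_eq0 (negPf vv) orbF subr_eq0.
by rewrite sqrp_eq1 ?normr_ge0// => /eqP.
Qed.

Lemma unitary_row_neq0 (P : 'M[C]_m.+1) j : P \is unitarymx -> row j P != 0.
Proof.
move=> /unitarymxP/matrixP/(_ j j) PP; apply: contra_eq_neq PP => Pj.
rewrite !mxE eqxx big1 1?eq_sym ?oner_neq0// => i _.
by move/rowP: Pj => /(_ i); rewrite !mxE => ->; rewrite mul0r.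
Qed.

(** The rows of [P] are orthonormal left eigenvectors. If two of them shared an eigenvalue, a
    combination with zero first entry would vanish by [M_first], against their independence. *)
Lemma unitary_simple_spectrum : exists (P : 'M[C]_m.+1) (z : 'I_m.+1 -> C),
  [/\ P \is unitarymx, P *m M = diag_mx (\row_j z j) *m P,
      injective z, forall j, `|z j| = 1 & forall j, P j 0 != 0].
Proof.
have /orthomx_spectralP ME : M \is normalmx.
  by apply/normalmxP; rewrite (unitarymxP MU) (mulmx1C (unitarymxP MU)).
set P := spectralmx M in ME; set d := spectral_diag M in ME.
have PU : P \is unitarymx by exact: spectral_unitarymx.
have PM : P *m M = diag_mx d *m P.
  by rewrite ME !mulmxA mulmxV ?mul1mx ?unitarymx_unit.
have rowPM j : row j P *m M = d 0 j *: row j P.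
  by rewrite -row_mul PM row_mul row_diag_mx -scalemxAl -rowE.
have P0 j := unitary_row_neq0 j PU.
have d1 j : `|d 0 j| = 1 by exact: mulmx_unitary_norm (rowPM j).
have d0 j : d 0 j != 0 by rewrite -normr_gt0 d1 ltr01.
have Pj0 j : P j 0 != 0.
  by apply: contraNneq (P0 j) => Pj0; apply/eqP/(M_first (d0 j)); rewrite ?mxE.
exists P, (d 0); split => //.
  by rewrite PM; congr (diag_mx _ *m _); apply/rowP => j; rewrite mxE.
move=> j k djk; apply/eqP; apply: contraT => jk.
have := M_first (d0 j) (v := P k 0 *: row j P - P j 0 *: row k P).
rewrite !mxE mulrC subrr mulmxBl -!scalemxAl !rowPM -djk scalerBr !scalerA.
rewrite ![_ * d 0 j]mulrC => /(_ erefl erefl)/rowP E.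
(* Pairing the vanishing combination with row [j] isolates [P k 0], which is nonzero. *)
have : \sum_i (P k 0 * P j i - P j 0 * P k i) * (P j i)^* = 0.
  by apply: big1 => i _; have := E i; rewrite !mxE => ->; rewrite mul0r.
have U i1 i2 : \sum_i P i1 i * (P i2 i)^* = (i1 == i2)%:R.
  have /matrixP/(_ i1 i2) := unitarymxP PU; rewrite !mxE => <-.
  by apply: eq_bigr => i _; rewrite !mxE.
under eq_bigr => i _ do rewrite mulrBl -!mulrA.
rewrite sumrB -!mulr_sumr !U eqxx eq_sym (negPf jk) mulr1 mulr0 subr0 => /eqP.
by rewrite (negPf (Pj0 k)).
Qed.

Lemma eigenvalue_spectrum (P : 'M[C]_m.+1) (z : 'I_m.+1 -> C) :
  P \is unitarymx -> P *m M = diag_mx (\row_j z j) *m P ->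
  forall x, eigenvalue M x <-> exists j, z j = x.
Proof.
move=> PU PM x; split => [/eigenvalueP[v vM v0]|[j <-]].
  have vP : v *m P^t* *m P = v by exact: mulmxKtV.
  have : v *m P^t* != 0 by apply: contraNneq v0 => vP0; rewrite -vP vP0 mul0mx.
  case/rV0Pn => j vj; exists j.
  have : v *m P^t* *m diag_mx (\row_j z j) = x *: (v *m P^t*).
    by rewrite scalemxAl -vM -[in RHS]vP -[_ *m P *m M]mulmxA PM mulmxA mulmxtVK.
  move: (v *m P^t*) vj => w vj.
  by rewrite mul_mx_diag => /rowP/(_ j); rewrite !mxE mulrC => /(mulIf vj).
apply/eigenvalueP; exists (row j P).
  by rewrite -row_mul PM row_mul row_diag_mx mxE -scalemxAl -rowE.
exact: unitary_row_neq0.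
Qed.

End UnitarySpectrum.

(** * Szegő polynomials and the spectrum of the capped snake *)

Section Szego.
Variable R : realType.
Local Notation C := R[i].
Variables (phi : nat -> {poly C}) (alpha : nat -> C).
Hypothesis size_phi : forall k, size (phi k) = k.+1.
Hypothesis phi0 : phi 0%N = 1.
Hypothesis schur : schur_parameters phi alpha.

Local Notation f z := (fun k => (phi k).[z]).
Local Notation g z := (fun k => (reversed k (phi k)).[z]).

Let alpha1 k : `|alpha k| < 1. Proof. by case: (schur k). Qed.
Let rho0 k : rho alpha k != 0. Proof. exact/lt0r_neq0/rho_gt0. Qed.

Let schurf z k : z * f z k = (alpha k)^* * g z k + rho alpha k * f z k.+1.
Proof.
by case: (schur k) => _ /(congr1 (horner^~ z)) + _; rewrite !hornerE => ->.
Qed.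

Let schurg z k : g z k.+1 = rho alpha k * g z k - alpha k * f z k.+1.
Proof.
by case: (schur k) => _ _ /(congr1 (horner^~ z)); rewrite !hornerE => ->.
Qed.

Let reversed0 : reversed 0 (phi 0%N) = 1.
Proof.
rewrite /reversed phi0; apply/polyP => i; rewrite coef_poly !coef1.
by case: i => [|i] //=; rewrite rmorph1.
Qed.

Lemma norm_reversed k (p : {poly C}) (z : C) : (size p <= k.+1)%N -> `|z| = 1 ->
  `|(reversed k p).[z]| = `|p.[z]|.
Proof.
move=> sp z1; have z0 : z != 0 by rewrite -normr_gt0 z1 ltr01.
have zV : (z^*)^-1 = z.
  by rewrite invC_norm norm_conjC z1 expr1n invr1 mul1r conjCK.
by rewrite reversedE// zV normrM normrX z1 expr1n mul1r norm_conjC.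
Qed.

(** For unimodular [c] this is the classical para-orthogonal polynomial of degree [m.+1]; when [c]
    is the conjugate of [alpha m] it equals [rho alpha m *: phi m.+1]. *)
Definition paraorthogonal m (c : C) : {poly C} :=
  'X * phi m - c *: reversed m (phi m).

Lemma root_paraorthogonal m c z :
  root (paraorthogonal m c) z = (z * f z m == c * g z m).
Proof. by rewrite rootE !hornerE subr_eq0. Qed.

Lemma size_reversed m : (size (- (reversed m (phi m))) < size ('X * phi m)%R)%N.
Proof.
have pm : phi m != 0 by rewrite -size_poly_eq0 size_phi.
by rewrite size_polyN mulrC size_mulX// size_phi ltnS size_poly.
Qed.

Section Matrix.
Variables (s : nat -> bool) (m : nat) (c1 c2 c3 : C).
Local Notation M c := (capped_snake alpha s m c c1 c2 c3).

Lemma rowvecE n (v : 'rV[C]_n.+1) : v = rowvec n.+1 (fun i => v 0 (inord i)).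
Proof. by apply/rowP => i; rewrite mxE inord_val. Qed.

(** Only the first [m] equations are assumed, so that the lemma covers combinations with a basis row
    whose last equation may fail. *)
Lemma capped_snake_first (c z : C) (v : 'rV[C]_m.+1) : c != 0 -> z != 0 ->
  v 0 0 = 0 -> (forall i : 'I_m.+1, (i < m)%N -> (v *m M c) 0 i = z * v 0 i) ->
  v = 0.
Proof.
move=> c0 z0 v0 vM.
have E := capped_act_eigen_eq0 (s := s) rho0 z0 c0 (v := fun i => v 0 (inord i)).
apply/rowP => i; rewrite mxE -(inord_val i); apply: E; last exact: leq_ord.
  by rewrite -[RHS]v0; congr (v _ _); apply: val_inj; rewrite /= inordK.
move=> k km; have := vM (inord k); rewrite {1}[v]rowvecE rowvec_capped_snake mxE.
by rewrite inordK ?(leqW km)//; apply.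
Qed.

Local Notation y z c :=
  (capped_basis s z (f z) (g z) m c).

Lemma norm_capped_basis (z c : C) i : `|z| = 1 -> `|c| = 1 -> (i <= m)%N ->
  `|y z c i| = `|f z i|.
Proof.
move=> z1 c1'; have sh k : `|shift s z k| = 1.
  by rewrite normrX normfV z1 invr1 expr1n.
rewrite /capped_basis /snake_basis => im; case: eqP => [->|_]; rewrite !normrM sh mul1r.
  by case: ifP; rewrite ?normr1 ?normfV ?c1' ?invr1 mulr1.
case: ifP => // _; rewrite normrM normfV z1 invr1 mul1r.
by rewrite norm_reversed ?size_phi.
Qed.

Lemma capped_snake_basis (z c : C) : z != 0 -> c != 0 -> exists2 e, e != 0 &
  forall i : 'I_m.+1, (rowvec m.+1 (y z c) *m M c) 0 i =
    z * y z c i + (i == m :> nat)%:R * (e * (c * g z m - z * f z m)).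
Proof.
move=> z0 c0.
have fg : f z 0%N = g z 0%N by rewrite /= reversed0 phi0.
have /= [lt_m [e e0 eq_m]] := capped_act_basis s z0 (schurf z) (schurg z) m fg c0.
exists e => // i; rewrite rowvec_capped_snake mxE.
case: (eqVneq (i : nat) m) => [->|im]; first by rewrite eq_m mul1r.
by rewrite lt_m ?mul0r ?addr0// ltn_neqAle im -ltnS ltn_ord.
Qed.

(** The row [v] and the basis row [Y] satisfy the same first [m] equations, hence are proportional
    by [capped_snake_first]. The moduli are then those of [Y], and the last equation forces the
    defect of [Y] to vanish. *)
Lemma capped_snake_eigen (z c : C) (v : 'rV[C]_m.+1) : `|z| = 1 -> `|c| = 1 ->
  v *m M c = z *: v ->
  (forall i : 'I_m.+1, `|v 0 i| = `|v 0 0| * `|f z i|) /\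
  (v != 0 -> root (paraorthogonal m c) z).
Proof.
move=> z1 c1' vM.
have z0 : z != 0 by rewrite -normr_gt0 z1 ltr01.
have c0 : c != 0 by rewrite -normr_gt0 c1' ltr01.
have [e e0 yM] := capped_snake_basis z0 c0.
set Y := rowvec _ _ in yM.
have y00 : `|y z c 0%N| = 1 by rewrite norm_capped_basis//= phi0 hornerE normr1.
have y0 : y z c 0%N != 0 by rewrite -normr_gt0 y00 ltr01.
have vY : y z c 0%N *: v - v 0 0 *: Y = 0.
  apply: (capped_snake_first c0 z0); first by rewrite !mxE mulrC subrr.
  move=> i im; rewrite mulmxBl -!scalemxAl vM.
  have := yM i; rewrite (ltn_eqF im) mul0r addr0.
  by move: (Y *m M c) => W Wi; rewrite !mxE Wi; ring.
have {}vY : v = (v 0 0 / y z c 0%N) *: Y.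
  have /eqP := vY; rewrite subr_eq0 => /eqP E.
  by rewrite mulrC -scalerA -E scalerA mulVf// scale1r.
split=> [i|v0].
  by rewrite vY !mxE divfK// normrM normf_div y00 divr1 norm_capped_basis// -ltnS.
have := yM ord_max; rewrite eqxx mul1r => yMm.
have v00 : v 0 0 / y z c 0%N != 0.
  by apply: contraNneq v0 => v0; rewrite vY v0 scale0r.
set k := v 0 0 / _ in vY v00.
have /(scalerI v00) : k *: (Y *m M c) = k *: (z *: Y).
  by rewrite scalemxAl -vY vM {1}vY !scalerA mulrC.
move=> /rowP/(_ ord_max); rewrite yMm !mxE => /eqP.
rewrite -subr_eq0 addrAC subrr add0r mulf_eq0 (negPf e0)/= subr_eq0 eq_sym.
by rewrite root_paraorthogonal.
Qed.

End Matrix.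

Section CharPoly.
Variables (s : nat -> bool) (m : nat) (c1 c2 c3 : C).
Local Notation M c := (capped_snake alpha s m c c1 c2 c3).

Lemma capped_snake_spectrum c : `|c| = 1 ->
  exists (P : 'M[C]_m.+1) (z : 'I_m.+1 -> C),
  [/\ P \is unitarymx, P *m M c = diag_mx (\row_j z j) *m P,
      injective z, forall j, `|z j| = 1 /\ root (paraorthogonal m c) (z j) &
      forall j, P j 0 != 0].
Proof.
move=> c1'; have MU := unitary_capped_snake s m c1 c2 c3 alpha1 c1'.
have c0 : c != 0 by rewrite -normr_gt0 c1' ltr01.
have [|P [z [PU PM zI z1 P0]]] := unitary_simple_spectrum MU.
  move=> a v a0 v0 vM; apply: (@capped_snake_first s m c1 c2 c3 c a v) => // i _.
  by rewrite vM mxE.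
exists P, z; split => // j; split => //.
have rowPM : row j P *m M c = z j *: row j P.
  by rewrite -row_mul PM row_mul row_diag_mx mxE -scalemxAl -rowE.
have [_] := capped_snake_eigen (z1 j) c1' rowPM.
by apply; apply: unitary_row_neq0.
Qed.

Lemma capped_snake_corner c :
  M c = if s m then corner_mx m c *m M 1 else M 1 *m corner_mx m c.
Proof.
have corner (a : C) v : rowvec m.+1 v *m corner_mx m a = rowvec m.+1 (scale m a v).
  rewrite /corner_mx mul_mx_diag; apply/rowP => j; rewrite !mxE /scale -val_eqE /=.
  by case: ifP => _; rewrite ?mulr1// mulrC.
have scale1 v : scale m 1 v = v.
  by apply/funext => j; rewrite /scale mul1r if_same.
apply: rowvec_ext => v; case: ifP => sm.
  by rewrite mulmxA corner !rowvec_capped_snake /capped_act sm scale1.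
by rewrite mulmxA !rowvec_capped_snake corner /capped_act sm scale1.
Qed.

(* For |c| = 1 the two sides have the same m + 1 distinct roots; both are     *)
(* affine in c.                                                               *)
Lemma char_poly_capped_snake c :
  lead_coef (phi m) *: char_poly (M c) = paraorthogonal m c.
Proof.
have unimodular a : `|a| = 1 ->
    lead_coef (phi m) *: char_poly (M a) = paraorthogonal m a.
  move=> a1; have [P [z [PU PM zI zP _]]] := capped_snake_spectrum a1.
  have sN := size_reversed m.
  have sc : (size (- (a *: reversed m (phi m))) < size ('X * phi m)%R)%N.
    by rewrite -scalerN (leq_ltn_trans (size_scale_leq _ _)).
  have pm : phi m != 0 by rewrite -size_poly_eq0 size_phi.
  have spsi : size (paraorthogonal m a) = m.+2.
    by rewrite size_polyDl// mulrC size_mulX// size_phi.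
  have := proportional_roots zI (size_char_poly (M a)) spsi.
  rewrite (monicP (char_poly_monic _)) scale1r => <-.
  - by rewrite lead_coefDl// mulrC lead_coefMX.
  - move=> j; rewrite -eigenvalue_root_char.
    by apply/(eigenvalue_spectrum PU PM); exists j.
  - by move=> j; case: (zP j).
have two : 2%:R != 0 :> C by rewrite pnatr_eq0.
have -> : char_poly (M c) = ((1 + c) / 2%:R) *: char_poly (M 1) +
                            ((1 - c) / 2%:R) *: char_poly (M (-1)).
  rewrite (capped_snake_corner c) (capped_snake_corner (-1)).
  rewrite [in X in X + _](capped_snake_corner 1); case: ifP => _.
    exact: char_poly_corner.
  (* Transposition moves the corner factor from the right to the left. *)
  rewrite -!(char_poly_trmx (_ *m _)) !trmx_mul /corner_mx !tr_diag_mx.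
  exact: char_poly_corner.
rewrite scalerDr !scalerA ![lead_coef _ * _]mulrC -!scalerA.
rewrite !unimodular ?normrN ?normr1// /paraorthogonal !scalerBr !scalerA.
rewrite addrACA -scalerDl -mulrDl addrACA subrr addr0 divff// scale1r.
congr (_ + _); rewrite -opprD -scalerDl; congr (- (_ *: _)).
by field.
Qed.

End CharPoly.

Section Discrete.
Local Open Scope sesquilinear_scope.
Variables (m : nat) (c : C) (z : 'I_m.+1 -> C).
Hypotheses (c1 : `|c| = 1) (zI : injective z) (z1 : forall j, `|z j| = 1).
Hypothesis zP : forall j, root (paraorthogonal m c) (z j).

(** The Christoffel function at [z j]: the reciprocal of the reproducing kernel on the diagonal. *)
Definition christoffel j : C := (\sum_(k < m.+1) `|(phi k).[z j]| ^+ 2)^-1.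

(** Eigenrows of a unitary matrix for distinct eigenvalues are orthogonal. As a one-sided inverse of
    a square matrix is two-sided, this orthogonality of the rows of [V], indexed by nodes, becomes
    weighted orthonormality of its columns, indexed by degrees. *)
Lemma discrete_orthonormal k l : (k <= m)%N -> (l <= m)%N ->
  \sum_j christoffel j * ((phi k).[z j]^* * (phi l).[z j]) = (k == l)%:R.
Proof.
move=> km lm.
(* With s = 0 the left eigenvectors of the capped snake are the rows of V. *)
pose V : 'M[C]_m.+1 := \matrix_(j, k) (phi k).[z j].
pose M := capped_snake alpha (fun=> false) m c 0 0 0.
have MU : M \is unitarymx by exact: unitary_capped_snake.
have z0 j : z j != 0 by rewrite -normr_gt0 z1 ltr01.
have c0 : c != 0 by rewrite -normr_gt0 c1 ltr01.
have VM : V *m M = diag_mx (\row_j z j) *m V.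
  apply/row_matrixP => j; rewrite !row_mul row_diag_mx mxE -scalemxAl -rowE.
  have [e _ yM] := capped_snake_basis (fun=> false) m 0 0 0 (z0 j) c0.
  have yE : capped_basis (fun=> false) (z j) (f (z j)) (g (z j)) m c = f (z j).
    apply/funext => i; rewrite /capped_basis /snake_basis /shift !big1//.
    by rewrite expr0 mulr1 !mul1r; case: eqP => // ->.
  have -> : row j V = rowvec m.+1 (f (z j)) by apply/rowP => i; rewrite !mxE.
  apply/rowP => i; move: (yM i); rewrite yE => ->; rewrite !mxE.
  have := zP j; rewrite root_paraorthogonal eq_sym -subr_eq0 => /eqP ->.
  by rewrite !mulr0 addr0.
have S0 j : 0 < \sum_(k < m.+1) `|(phi k).[z j]| ^+ 2.
  by rewrite big_ord_recl phi0 hornerE normr1 expr1n ltr_pwDl ?ltr01// sumr_ge0.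
have VV : V *m V^t* = diag_mx (\row_j (christoffel j)^-1).
  have : (V *m M) *m (V *m M)^t* = V *m V^t*.
    by rewrite trmx_mul map_mxM mulmxA mulmxtVK.
  rewrite VM trmx_mul map_mxM mulmxA -(mulmxA _ V) => E.
  apply/matrixP => i j; rewrite [RHS]mxE [X in X *+ _]mxE.
  case: (eqVneq i j) => [->|ij].
    rewrite mulr1n invrK mxE; apply: eq_bigr => k' _.
    by rewrite !mxE normCK.
  move/matrixP: E => /(_ i j)/esym.
  rewrite mulr0n tr_diag_mx map_diag_mx mul_mx_diag mul_diag_mx mxE.
  rewrite [X in X * _]mxE; move: (V *m V^t*) => W; rewrite !mxE => /eqP.
  (* The entry is fixed under multiplication by [z i * (z j)^*], and this product equals 1 only if
     [z i = z j]. *)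
  rewrite mulrAC -subr_eq0 -[X in X - _]mul1r -mulrBl mulf_eq0 subr_eq0.
  case/orP=> [/eqP zz|/eqP//]; case/eqP: ij; apply: zI.
  by rewrite -[RHS]mul1r zz -mulrA [_^* * _]mulrC -normCK z1 expr1n mulr1.
have W : V *m (V^t* *m diag_mx (\row_j christoffel j)) = 1%:M.
  rewrite mulmxA VV mulmx_diag -[RHS]diag_const_mx; congr diag_mx.
  apply/rowP => j; rewrite !mxE mulVf// invr_eq0.
  exact/lt0r_neq0/S0.
have /matrixP := mulmx1C W.
move=> /(_ (Ordinal (km : (k < m.+1)%N)) (Ordinal (lm : (l < m.+1)%N))).
rewrite [RHS]mxE -val_eqE /= => <-; rewrite mxE; apply: eq_bigr => j _.
by rewrite mul_mx_diag !mxE /=; ring.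
Qed.

End Discrete.
End Szego.

(** * Linearity of the integral over the circle *)

Section CircleIntegral.
Variable R : realType.
Local Notation C := R[i].

(** A class closed under the ring operations and integrable for [mu], which makes linearity of the
    integral available throughout. *)
Definition bounded_measurable (u : R -> R) : Prop :=
  measurable_fun [set: measurableTypeR R] u /\ exists M : R, forall t, `|u t| <= M.

Lemma bounded_measurable_cst a : bounded_measurable (fun=> a).
Proof. by split; [exact: measurable_cst | exists `|a|]. Qed.

Lemma bounded_measurableD u v : bounded_measurable u -> bounded_measurable v ->
  bounded_measurable (fun t => u t + v t).
Proof.
move=> [mu [M uM]] [mv [N vN]]; split; first exact: measurable_funD.
by exists (M + N) => t; rewrite (le_trans (ler_normD _ _))// lerD.
Qed.

Lemma bounded_measurableM u v : bounded_measurable u -> bounded_measurable v ->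
  bounded_measurable (fun t => u t * v t).
Proof.
move=> [mu [M uM]] [mv [N vN]]; split; first exact: measurable_funM.
by exists (M * N) => t; rewrite normrM ler_pM.
Qed.

Definition circle_bounded (f : C -> C) : Prop :=
  bounded_measurable (fun t => complex.Re (f (expi t))) /\
  bounded_measurable (fun t => complex.Im (f (expi t))).

Lemma ReM (x y : C) : complex.Re (x * y) =
  complex.Re x * complex.Re y - complex.Im x * complex.Im y.
Proof. by case: x; case: y. Qed.

Lemma ImM (x y : C) : complex.Im (x * y) =
  complex.Re x * complex.Im y + complex.Im x * complex.Re y.
Proof. by case: x; case: y. Qed.

Lemma eq_circle_bounded f g : (forall t, f (expi t) = g (expi t)) ->
  circle_bounded f -> circle_bounded g.
Proof.
by move=> fg; rewrite /circle_bounded; under eq_fun do rewrite fg;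
   under [in X in _ /\ X]eq_fun do rewrite fg.
Qed.

Lemma circle_bounded_cst a : circle_bounded (fun=> a).
Proof. by split; exact: bounded_measurable_cst. Qed.

Lemma circle_bounded_id : circle_bounded id.
Proof.
split; split.
- by apply: continuous_measurable_fun; exact: continuous_cos.
- by exists 1 => t; rewrite ler_norml cos_geN1 cos_le1.
- by apply: continuous_measurable_fun; exact: continuous_sin.
- by exists 1 => t; rewrite ler_norml sin_geN1 sin_le1.
Qed.

Lemma circle_boundedD f g : circle_bounded f -> circle_bounded g ->
  circle_bounded (fun z => f z + g z).
Proof.
move=> [f1 f2] [g1 g2].
have E1 (x y : C) : complex.Re (x + y) = complex.Re x + complex.Re y.
  by case: x; case: y.
have E2 (x y : C) : complex.Im (x + y) = complex.Im x + complex.Im y.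
  by case: x; case: y.
by split; under eq_fun do rewrite ?E1 ?E2; exact: bounded_measurableD.
Qed.

Lemma bounded_measurableN u : bounded_measurable u ->
  bounded_measurable (fun t => - u t).
Proof.
move=> [mu [M uM]]; split; first exact: measurable_funN.
by exists M => t; rewrite normrN.
Qed.

Lemma circle_boundedM f g : circle_bounded f -> circle_bounded g ->
  circle_bounded (fun z => f z * g z).
Proof.
move=> [f1 f2] [g1 g2].
split; under eq_fun do rewrite ?ReM ?ImM; apply: bounded_measurableD;
  try apply: bounded_measurableN; exact: bounded_measurableM.
Qed.

Lemma circle_bounded_conj f : circle_bounded f -> circle_bounded (fun z => (f z)^*).
Proof.
move=> [f1 f2].
have E1 (x : C) : complex.Re x^* = complex.Re x by case: x.
have E2 (x : C) : complex.Im x^* = - complex.Im x by case: x.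
split; first by under eq_fun do rewrite E1.
by under eq_fun do rewrite E2; exact: bounded_measurableN.
Qed.

Lemma circle_bounded_sum n (F : 'I_n -> C -> C) :
  (forall k, circle_bounded (F k)) -> circle_bounded (fun z => \sum_(k < n) F k z).
Proof.
elim: n F => [|n IH] F FP.
  by under eq_fun do rewrite big_ord0; exact: circle_bounded_cst.
under eq_fun do rewrite big_ord_recl.
by apply: circle_boundedD => //; apply: IH.
Qed.

Lemma circle_bounded_horner (p : {poly C}) : circle_bounded (horner p).
Proof.
elim/poly_ind: p => [|p c IH].
  rewrite (_ : horner 0 = fun=> 0); first exact: circle_bounded_cst.
  by apply/funext => z; rewrite horner0.
rewrite (_ : horner _ = fun z => p.[z] * z + c); last first.
  by apply/funext => z; rewrite hornerMXaddC.
apply: circle_boundedD; last exact: circle_bounded_cst.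
by apply: circle_boundedM => //; exact: circle_bounded_id.
Qed.

Lemma norm_expi t : `|expi t| = 1 :> C.
Proof. by rewrite normc_def /= cos2Dsin2 sqrtr1. Qed.

Variable mu : probability (measurableTypeR R) R.

Let angles_measurable : measurable (@angles R : set (measurableTypeR R)).
Proof. exact: measurable_itv. Qed.

Lemma bounded_measurable_integrable u : bounded_measurable u ->
  mu.-integrable (@angles R) (EFin \o u).
Proof.
move=> [mu' [M uM]]; apply: measurable_bounded_integrable => //.
- by rewrite (le_lt_trans (probability_le1 _ _))// ltry.
- exact: measurable_funTS.
- by exists M; split; rewrite ?num_real// => N MN t _ /=; rewrite (le_trans (uM t))// ltW.
Qed.

Lemma eq_circle_integral f g : (forall t, f (expi t) = g (expi t)) ->
  circle_integral mu f = circle_integral mu g.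
Proof.
move=> fg; rewrite /circle_integral.
by congr (_ +i* _)%C; apply: eq_Rintegral => t _ /=; rewrite fg.
Qed.

Lemma circle_integralD f g : circle_bounded f -> circle_bounded g ->
  circle_integral mu (fun z => f z + g z) =
  circle_integral mu f + circle_integral mu g.
Proof.
move=> [f1 f2] [g1 g2]; rewrite /circle_integral.
apply/eqP; rewrite eq_complex /=; apply/andP; split; apply/eqP.
  rewrite -RintegralD//; try exact: bounded_measurable_integrable.
  by apply: eq_Rintegral => t _; case: (f _); case: (g _).
rewrite -RintegralD//; try exact: bounded_measurable_integrable.
by apply: eq_Rintegral => t _; case: (f _); case: (g _).
Qed.

Lemma circle_integralZ a f : circle_bounded f ->
  circle_integral mu (fun z => a * f z) = a * circle_integral mu f.
Proof.
move=> [f1 f2]; rewrite /circle_integral.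
have I u : bounded_measurable u -> mu.-integrable (@angles R) (EFin \o u).
  exact: bounded_measurable_integrable.
have Z r u : bounded_measurable u -> bounded_measurable (fun t => r * u t).
  by move=> uP; apply: bounded_measurableM => //; exact: bounded_measurable_cst.
apply/eqP; rewrite eq_complex ReM ImM /=; apply/andP; split; apply/eqP.
  rewrite -!RintegralZl// ?I// -RintegralB// ?I//; try exact: Z.
  by apply: eq_Rintegral => t _; rewrite ReM.
rewrite -!RintegralZl// ?I// -RintegralD// ?I//; try exact: Z.
by apply: eq_Rintegral => t _; rewrite ImM.
Qed.

Lemma circle_integral_sum n (F : 'I_n -> C -> C) :
  (forall k, circle_bounded (F k)) ->
  circle_integral mu (fun z => \sum_(k < n) F k z) =
  \sum_(k < n) circle_integral mu (F k).
Proof.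
elim: n F => [|n IH] F FP.
  rewrite big_ord0 -[RHS](mul0r (circle_integral mu (fun=> 0))) -circle_integralZ.
    by apply: eq_circle_integral => t; rewrite big_ord0 mul0r.
  exact: circle_bounded_cst.
rewrite big_ord_recl -IH// -circle_integralD//; last exact: circle_bounded_sum.
by apply: eq_circle_integral => t; rewrite big_ord_recl.
Qed.

Hypothesis mu_circle : on_circle mu.

Lemma circle_integral1 : circle_integral mu (fun=> 1) = 1.
Proof.
have mu1 : mu (@angles R) = 1%E.
  have := probability_setC mu angles_measurable; rewrite mu_circle => /esym/eqP.
  by rewrite sube_eq ?add0e// ?fin_num_adde_defr// => /eqP.
transitivity ((1 * fine (1%E : \bar R)) +i* (0 * fine (1%E : \bar R)))%C.
  by rewrite /circle_integral !Rintegral_cst// -mu1.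
by rewrite /= mulr1 mul0r.
Qed.

End CircleIntegral.

(** * From discrete orthonormality to exact quadrature *)

Section Quadrature.
Variables (R : realType) (mu : probability (measurableTypeR R) R).
Local Notation C := R[i].
Hypothesis mu_circle : on_circle mu.
Variables (phi : nat -> {poly C}).
Hypothesis phi_szego : szego_polynomials mu phi.

Lemma szego0 : phi 0%N = 1.
Proof.
have [sz lc orth] := phi_szego.
have /eqP/size_poly1P[a a0 phiE] : size (phi 0%N) = 1%N by exact: sz.
have := lc 0%N; rewrite phiE lead_coefC => a_gt0.
have := orth 0%N 0%N; rewrite eqxx /inner phiE.
rewrite (@eq_circle_integral _ _ _ (fun=> a^* * a * 1)); last first.
  by move=> t; rewrite hornerC mulr1.
rewrite (circle_integralZ mu _ (f := fun=> 1)); last exact: circle_bounded_cst.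
rewrite circle_integral1// mulr1 conj_Creal ?gtr0_real// => /eqP.
by rewrite -expr2 sqrp_eq1 ?ltW// => /eqP ->.
Qed.

(** There is one [phi k] in each degree, so subtracting a multiple of it removes the leading
    term. *)
Lemma szego_span_ind (m : nat) (P : {poly C} -> Prop) : P 0 ->
  (forall a k p, (k <= m)%N -> P p -> P (a *: phi k + p)) ->
  forall p : {poly C}, (size p <= m.+1)%N -> P p.
Proof.
have [sz lc _] := phi_szego.
move=> P0 PS p; move: {2}(size p) (leqnn (size p)) => n.
elim: n p => [|n IH] p; first by rewrite leqn0 size_poly_eq0 => /eqP->.
move=> pn pm; have [|np] := leqP (size p) n; first by move/IH; apply.
have spn : size p = n.+1 by apply/eqP; rewrite eqn_leq pn.
have l0 : lead_coef (phi n) != 0 by exact/lt0r_neq0.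
pose a := lead_coef p / lead_coef (phi n).
have -> : p = a *: phi n + (p - a *: phi n) by rewrite addrC subrK.
have sn : (size (p - a *: phi n)%R <= n)%N.
  apply/leq_sizeP => j; rewrite leq_eqVlt coefB coefZ => /predU1P[<-|nj].
    have -> : (phi n)`_n = lead_coef (phi n) by rewrite lead_coefE sz.
    by rewrite divfK// lead_coefE spn subrr.
  by rewrite !nth_default ?mulr0 ?subr0// ?sz// spn.
apply: PS; first by rewrite -ltnS -spn.
by apply: IH => //; rewrite (leq_trans sn)// ltnW// -spn.
Qed.

Lemma circle_bounded_inner (p q : {poly C}) :
  circle_bounded (fun z => p.[z]^* * q.[z]).
Proof.
apply: circle_boundedM; last exact: circle_bounded_horner.
exact/circle_bounded_conj/circle_bounded_horner.
Qed.

Lemma innerDl a (p1 p2 q : {poly C}) :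
  inner mu (horner (a *: p1 + p2)) (horner q) =
  a^* * inner mu (horner p1) (horner q) + inner mu (horner p2) (horner q).
Proof.
have cb := circle_bounded_inner.
rewrite /inner -circle_integralZ// -circle_integralD//.
  by apply: eq_circle_integral => t; rewrite hornerD hornerZ rmorphD rmorphM/=; ring.
by apply: circle_boundedM => //; exact: circle_bounded_cst.
Qed.

Lemma innerDr a (p q1 q2 : {poly C}) :
  inner mu (horner p) (horner (a *: q1 + q2)) =
  a * inner mu (horner p) (horner q1) + inner mu (horner p) (horner q2).
Proof.
have cb := circle_bounded_inner.
rewrite /inner -circle_integralZ// -circle_integralD//.
  by apply: eq_circle_integral => t; rewrite hornerD hornerZ; ring.
by apply: circle_boundedM => //; exact: circle_bounded_cst.
Qed.

Lemma inner0l (q : {poly C}) : inner mu (horner 0) (horner q) = 0.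
Proof.
have := innerDl (-1) 0 0 q; rewrite scaler0 addr0 rmorphN rmorph1 mulN1r => ->.
by rewrite addNr.
Qed.

Lemma inner0r (p : {poly C}) : inner mu (horner p) (horner 0) = 0.
Proof.
by have := innerDr (-1) p 0 0; rewrite scaler0 addr0 mulN1r => ->; rewrite addNr.
Qed.

(** By sesquilinearity the rule is exact on every product of a conjugated polynomial and a
    polynomial, both of degree at most [m]. On the circle, where inverse and conjugate agree, each
    power of [z] with exponent between [-m] and [m] is such a product. *)
Lemma szego_quadrature_orthonormal (m : nat) (z w : 'I_m.+1 -> C) :
  injective z -> (forall j, `|z j| = 1) ->
  (forall k l, (k <= m)%N -> (l <= m)%N ->
     \sum_j w j * ((phi k).[z j]^* * (phi l).[z j]) = (k == l)%:R) ->
  szego_quadrature mu z w.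
Proof.
move=> zI z1 orthw; have [_ _ orth] := phi_szego; split=> // c.
have exact_pq (p q : {poly C}) : (size p <= m.+1)%N -> (size q <= m.+1)%N ->
    \sum_j w j * (p.[z j]^* * q.[z j]) = inner mu (horner p) (horner q).
  move=> pm qm; pattern p; apply: szego_span_ind pm => [|a k {}p km IHp].
    by rewrite inner0l big1// => j _; rewrite horner0 rmorph0 mul0r mulr0.
  rewrite innerDl -IHp; have <- : \sum_j w j * ((phi k).[z j]^* * q.[z j]) =
      inner mu (horner (phi k)) (horner q).
    pattern q; apply: szego_span_ind qm => [|b l {IHp}q lm IHq].
      by rewrite inner0r big1// => j _; rewrite horner0 !mulr0.
    rewrite innerDr -IHq orth -(orthw k l)// mulr_sumr -big_split/=.
    by apply: eq_bigr => j _; rewrite hornerD hornerZ; ring.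
  rewrite mulr_sumr -big_split/=.
  by apply: eq_bigr => j _; rewrite hornerD hornerZ rmorphD rmorphM/=; ring.
have exact_z (k : 'I_(m.+1.*2.-1)) : exists p q : {poly C},
    [/\ (size p <= m.+1)%N, (size q <= m.+1)%N &
     forall x : C, `|x| = 1 -> x ^ (k%:Z - m%:Z) = p.[x]^* * q.[x]].
  have [mk|km] := leqP m k.
    exists 1, 'X^(k - m); split; rewrite ?size_poly1 ?size_polyXn//.
      by rewrite ltnS leq_subLR addnn -ltnS ltn_ord.
    by move=> x _; rewrite hornerC hornerXn rmorph1 mul1r subzn.
  exists 'X^(m - k), 1; split; rewrite ?size_poly1 ?size_polyXn//.
    by rewrite ltnS leq_subr.
  move=> x x1; rewrite hornerC hornerXn mulr1 -opprB subzn ?(ltnW km)// -exprnN.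
  by rewrite invC_norm normrX x1 expr1n expr1n invr1 mul1r.
transitivity (\sum_(k < m.+1.*2.-1) c k * \sum_j w j * z j ^ (k%:Z - m%:Z)).
  under eq_bigr => j _ do rewrite /laurent mulr_sumr.
  rewrite exchange_big; apply: eq_bigr => k _; rewrite mulr_sumr.
  by apply: eq_bigr => j _; rewrite mulrCA.
have cz (k : 'I_(m.+1.*2.-1)) : circle_bounded (fun x : C => x ^ (k%:Z - m%:Z)).
  have [p [q [_ _ pq]]] := exact_z k.
  apply: eq_circle_bounded (circle_bounded_inner p q) => t.
  by rewrite pq// norm_expi.
rewrite /laurent circle_integral_sum => [|k]; last first.
  by apply: circle_boundedM => //; exact: circle_bounded_cst.
apply: eq_bigr => k _; rewrite circle_integralZ//; congr (_ * _).
have [p [q [sp sq pq]]] := exact_z k.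
rewrite (@eq_circle_integral _ _ _ (fun x => p.[x]^* * q.[x])); last first.
  by move=> t; rewrite pq// norm_expi.
rewrite -[RHS]/(inner mu (horner p) (horner q)) -exact_pq//;
  by apply: eq_bigr => j _; rewrite pq.
Qed.

End Quadrature.

(** * First components of the normalized eigenvectors *)

Section NormalizedEigenvectors.
Local Open Scope sesquilinear_scope.
Variables (R : realType) (m : nat).
Local Notation C := R[i].

(** The columns of the adjoint of [P] are orthonormal right eigenvectors. Their first entries are
    the conjugates of the [P j 0], so the phase of [P j 0] makes them positive. *)
Lemma normalized_eigenvectors_exist (M P : 'M[C]_m.+1) (z : 'I_m.+1 -> C) :
  P \is unitarymx -> P *m M = diag_mx (\row_j z j) *m P ->
  (forall j, P j 0 != 0) -> exists v, normalized_eigenvectors ord0 M z v.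
Proof.
move=> PU PM P0; have nP j : `|P j 0| != 0 by rewrite normr_eq0.
have E : M *m P^t* = P^t* *m diag_mx (\row_j z j).
  rewrite -[LHS]mul1mx -(mulmx1C (unitarymxP PU)) -mulmxA; congr (_ *m _).
  by rewrite mulmxA PM mulmxtVK.
exists (fun j => (P j 0 / `|P j 0|) *: col j (P^t*)); split.
- move=> j; rewrite -scalemxAr colE mulmxA E -!colE.
  by apply/colP => i; rewrite mul_mx_diag !mxE; ring.
- move=> j k; have /matrixP/(_ j k) := unitarymxP PU; rewrite !mxE => PP.
  transitivity ((P j 0 / `|P j 0|)^* * (P k 0 / `|P k 0|) * (j == k)%:R).
    rewrite -PP mulr_sumr; apply: eq_bigr => i _.
    by rewrite !mxE rmorphM /= conjCK; ring.
  case: eqVneq => [<-|_]; last by rewrite mulr0.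
  by rewrite mulr1 mulrC -normCK normf_div normr_id divff// expr1n.
- move=> j; rewrite !mxE mulrAC -normCK expr2 mulfK//.
  by rewrite normr_gt0.
Qed.

(** For a unitary matrix the adjoint of a right eigenvector is a left eigenvector with the same
    eigenvalue. By [capped_snake_eigen] its entries have moduli proportional to those of [(phi
    k).[z j]], and unit norm fixes the first one. *)
Lemma normalized_eigenvectors_first (phi : nat -> {poly C}) (alpha : nat -> C)
    (s : nat -> bool) (c c1 c2 c3 : C) (z : 'I_m.+1 -> C) v :
  (forall k, size (phi k) = k.+1) -> phi 0%N = 1 ->
  schur_parameters phi alpha -> `|c| = 1 -> (forall j, `|z j| = 1) ->
  normalized_eigenvectors ord0 (capped_snake alpha s m c c1 c2 c3) z v ->
  forall j, v j 0 0 ^+ 2 = christoffel phi z j.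
Proof.
set M := capped_snake _ _ _ _ _ _ _.
move=> sz phi0 schur c_1 z1 [Mv vv v0] j.
have MU : M \is unitarymx.
  by apply: unitary_capped_snake => // k; case: (schur k).
have vM : (v j)^t* *m M = z j *: (v j)^t*.
  have : (v j)^t* *m M^t* = (z j)^* *: (v j)^t*.
    by rewrite -map_mxM -trmx_mul Mv linearZ /= map_mxZ.
  move=> /(congr1 (fun A => z j *: (A *m M))).
  by rewrite mulmxKtV// -scalemxAl scalerA -normCK z1 expr1n scale1r => ->.
have [nv _] := capped_snake_eigen sz phi0 schur (z1 j) c_1 vM.
have v0E : `|v j 0 0| = v j 0 0 by rewrite ger0_norm// ltW.
have E : v j 0 0 ^+ 2 * (\sum_(k < m.+1) `|(phi k).[z j]| ^+ 2) = 1.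
  rewrite mulr_sumr; transitivity (((j == j)%:R) : C); last by rewrite eqxx.
  rewrite -vv; apply: eq_bigr => k _.
  have := nv k; rewrite !mxE !norm_conjC v0E => vk.
  by rewrite [RHS]mulrC -normCK vk exprMn.
rewrite /christoffel -[RHS]mul1r -E mulfK//.
by apply: contra_eq_neq E => ->; rewrite mulr0 eq_sym oner_neq0.
Qed.

End NormalizedEigenvectors.

(* The weights are the squares of the (positive) first components: the first
   components themselves have squares adding up to the total mass 1. *)
Theorem corollary14 (R : realType) (mu : probability (measurableTypeR R) R)
    (mu_circle : on_circle mu) (mu_nondiscrete : nondiscrete mu)
    (phi : nat -> {poly R[i]}) (phi_szego : szego_polynomials mu phi)
    (alpha : nat -> R[i]) (alpha_schur : schur_parameters phi alpha)
    (s : nat -> bool) (n : nat) (n_gt0 : (0 < n)%N) :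
  (forall z : R[i],
     eigenvalue (principal n (snake alpha s)) z = root (phi n) z /\
     mup z (char_poly (principal n (snake alpha s))) = mup z (phi n)) /\
  (forall theta theta' : R,
     let M := truncated_snake alpha s theta theta' n in
     M \is unitarymx /\
     exists z : 'I_n -> R[i],
       [/\ injective z,
           forall x, eigenvalue M x <-> exists j, z j = x,
           forall j, `|z j| = 1 &
           exists w : 'I_n -> R[i],
             [/\ szego_quadrature mu z w,
                 exists v, normalized_eigenvectors (Ordinal n_gt0) M z v &
                 forall v, normalized_eigenvectors (Ordinal n_gt0) M z v ->
                   forall j, w j = (v j (Ordinal n_gt0) 0) ^+ 2]]).
Proof.
have [sz lc _] := phi_szego.
have phi0 := szego0 mu_circle phi_szego.
have alpha1 k : `|alpha k| < 1 by case: (alpha_schur k).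
case: n n_gt0 => [//|m] m_gt0.
have -> : Ordinal m_gt0 = ord0 by apply: val_inj.
split=> [z|theta theta'].
  (* The snake itself is the capped snake whose corner block is [givens alpha m]. *)
  have snakeE : principal m.+1 (snake alpha s) = capped_snake alpha s m
      (alpha m)^* (rho alpha m) (rho alpha m) (- alpha m).
    rewrite principal_snake; congr (principal _ (snake_product _ _ _)).
    by apply/funext => k; rewrite /capped_givens; case: eqP => // ->.
  have lm0 : lead_coef (phi m) != 0 by exact/lt0r_neq0.
  have rm0 : rho alpha m != 0 by exact/lt0r_neq0/rho_gt0.
  have := char_poly_capped_snake sz phi0 alpha_schur s m
    (rho alpha m) (rho alpha m) (- alpha m) (alpha m)^*.
  (* The Schur recurrence reduces the right-hand side to [rho alpha m *: phi m.+1]; an identity of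
     polynomials up to nonzero constants yields multiplicities as well as zeros. *)
  rewrite /paraorthogonal -snakeE; have [_ -> _] := alpha_schur m.
  rewrite addrAC subrr add0r => charE; split.
    by rewrite eigenvalue_root_char -(rootZ _ _ lm0) charE rootZ.
  by rewrite -(mupZ z _ lm0) charE mupZ.
move=> M; have -> : M = capped_snake alpha s m (expi theta) 0 0 (expi theta') by [].
move: (expi theta) (norm_expi theta) (expi theta') => {M} c c1 c3.
set M := capped_snake _ _ _ _ _ _ _.
have MU : M \is unitarymx by exact: unitary_capped_snake.
have [P [z [PU PM zI zP P0]]] := capped_snake_spectrum sz phi0 alpha_schur s m 0 0 c3 c1.
have z1 j : `|z j| = 1 by case: (zP j).
split=> //; exists z; split=> //; first exact: eigenvalue_spectrum PU PM.
exists (christoffel phi z); split.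
- apply: (szego_quadrature_orthonormal phi_szego zI z1) => k l km lm.
  by apply: (discrete_orthonormal phi0 alpha_schur c1 zI z1) => // j; case: (zP j).
- exact: normalized_eigenvectors_exist PU PM P0.
- move=> v vP j; rewrite (normalized_eigenvectors_first sz phi0 alpha_schur c1 z1 vP)//.
Qed.
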